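(* For every parity sequence $\boldsymbol s\in S_{m|n}$ and every $i=1,\dots,m+n$, \[T_i^{\boldsymbol s}=T_{\sigma_{\boldsymbol s}(i)}[\boldsymbol s_i^-]\,\frac{\pi_{\boldsymbol s_i^+,\boldsymbol s_i^-}}{\pi_{\boldsymbol s_i^++1,\boldsymbol s_i^-}[-1]}\quad\text{if } s_i=1,\qquad T_i^{\boldsymbol s}=T_{\sigma_{\boldsymbol s}(i)}[\boldsymbol s_i^+]\,\frac{\pi_{\boldsymbol s_i^+,\boldsymbol s_i^-+1}}{\pi_{\boldsymbol s_i^+,\boldsymbol s_i^-}[1]}\quad\text{if } s_i=-1.\]
   Context: Fix $h\in\mathbb{C}^\times$, $m,n\ge0$; $f[i](x)=f(x-ih)$. $S_{m|n}$: $\boldsymbol s\in\{\pm1\}^{m+n}$ with exactly $m$ entries $1$; $\boldsymbol s_0=(1,\dots,1,-1,\dots,-1)$; $\sigma_{\boldsymbol s}(i)=\#\{j\le i:s_j=1\}$ if $s_i=1$, $m+\#\{j\le i:s_j=-1\}$ if $s_i=-1$; $\boldsymbol s_i^+=\#\{j>i:s_j=1\}$, $\boldsymbol s_i^-=\#\{j<i:s_j=-1\}$. A polynomial $\mathfrak{gl}_{m|n}$ weight is $\lambda\in\mathbb{Z}^{m+n}_{\ge0}$ with $\lambda_1\ge\dots\ge\lambda_m$, $\lambda_{m+1}\ge\dots\ge\lambda_{m+n}$, $\lambda_{m+k}=0$ for $k>\lambda_m$; $L_\lambda$ the irreducible module of highest weight $\lambda$; $\lambda^{\boldsymbol s}_i$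 is the eigenvalue of $e_{\sigma_{\boldsymbol s}(i)\sigma_{\boldsymbol s}(i)}$ on the unique-up-to-scalar nonzero $v\in L_\lambda$ with $e_{\sigma_{\boldsymbol s}(a)\sigma_{\boldsymbol s}(b)}v=0$ for all $a<b$. Let $\boldsymbol\lambda=(\lambda^{(1)},\dots,\lambda^{(p)})$ be polynomial weights, $\lambda_i^{(k,\boldsymbol s)}=(\lambda^{(k)})^{\boldsymbol s}_i$, and $\boldsymbol z=(z_1,\dots,z_p)$ $h$-generic ($z_i-z_j\notin h\mathbb{Z}$ for $i\ne j$). $T_i^{\boldsymbol s}(x)=\prod_{k=1}^p\prod_{j=1}^{\lambda_i^{(k,\boldsymbol s)}}(x-z_k+s_ijh)$ and $T_i=T_i^{\boldsymbol s_0}$. For $a,b\ge0$, \[\pi_{a,b}(x)=\prod_{k=1}^p\prod_{i=1}^a\prod_{j=1}^{\min\{b,\lambda^{(k)}_{m-i+1}\}}(x-z_k+(i+j-a-b-1)h).\] *)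

(* Defs.v *)
From HB Require Import structures.
From mathcomp Require Import all_boot all_order all_algebra.
From mathcomp Require Import reals.
From mathcomp Require Import complex.
Set Implicit Arguments. Unset Strict Implicit. Unset Printing Implicit Defensive.
Import Order.TTheory GRing.Theory Num.Theory.
Local Open Scope ring_scope.

(* All index conventions are 1-based, as in the paper: indices of gl(m|n)
   run over 1..m+n; functions on nat are only ever used on that range. *)

Section Defs.
Variable K : fieldType.
Variables m n : nat.

Definition ipar (a : nat) : bool := (m < a)%N.
Definition psign (b : bool) : K := if b then -1 else 1.
Definition inrange (a : nat) : bool := (1 <= a <= m + n)%N.

(* A (Z/2-graded) vector space over K with a parity involution P and
   operators E a b representing the action of the basis e_{ab} of gl(m|n). *)
Record glmn_data := GlmnData {
  gl_V : lmodType K;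
  gl_P : {linear gl_V -> gl_V};
  gl_E : nat -> nat -> {linear gl_V -> gl_V} }.

(* gl(m|n)-module axioms:
   P is an involution (grading V = V_0 + V_1, V_0/V_1 = +1/-1 eigenspaces),
   e_{ab} has parity |a|+|b|, and the super-commutator relations
   [e_ab, e_cd] = d_bc e_ad - (-1)^{(|a|+|b|)(|c|+|d|)} d_da e_cb hold. *)
Definition is_glmn_module (M : glmn_data) : Prop :=
  [/\ forall v, gl_P M (gl_P M v) = v,
      forall a b v, inrange a -> inrange b ->
        gl_P M (gl_E M a b v) = psign (ipar a (+) ipar b) *: gl_E M a b (gl_P M v)
    & forall a b c d v, inrange a -> inrange b -> inrange c -> inrange d ->
        gl_E M a b (gl_E M c d v)
        - psign ((ipar a (+) ipar b) && (ipar c (+) ipar d)) *: gl_E M c d (gl_E M a b v)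
        = (if b == c then gl_E M a d v else 0)
          - (if d == a then psign ((ipar a (+) ipar b) && (ipar c (+) ipar d))
                              *: gl_E M c b v else 0)].

Definition is_graded_submodule (M : glmn_data) (W : gl_V M -> Prop) : Prop :=
  [/\ W 0,
      forall u v, W u -> W v -> W (u + v),
      forall (c : K) v, W v -> W (c *: v),
      forall v, W v -> W (gl_P M v)
    & forall a b v, inrange a -> inrange b -> W v -> W (gl_E M a b v)].

Definition irreducible_glmn (M : glmn_data) : Prop :=
  (exists v : gl_V M, v != 0) /\
  forall W : gl_V M -> Prop, is_graded_submodule W -> (forall v, W v -> v = 0) \/ (forall v, W v).

Definition has_highest_weight (M : glmn_data) (lam : nat -> nat) : Prop :=
  exists v : gl_V M, [/\ v != 0,
    forall a b, (1 <= a)%N -> (a < b)%N -> (b <= m + n)%N -> gl_E M a b v = 0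
  & forall a, inrange a -> gl_E M a a v = (lam a)%:R *: v].

Definition poly_weight (lam : nat -> nat) : Prop :=
  [/\ forall a, (1 <= a)%N -> (a < m)%N -> (lam a.+1 <= lam a)%N,
      forall a, (m + 1 <= a)%N -> (a < m + n)%N -> (lam a.+1 <= lam a)%N
    & (0 < m)%N -> forall k, (lam m < k)%N -> (k <= n)%N -> lam (m + k) = 0%N].

(* parity sequences s in S_{m|n}: s i = true means s_i = 1, false means s_i = -1 *)
Definition parity_seq (s : nat -> bool) : Prop :=
  count s (iota 1 (m + n)) = m.

Definition sigma_s (s : nat -> bool) (i : nat) : nat :=
  if s i then count s (iota 1 i) else (m + count (predC s) (iota 1 i))%N.

Definition s_plus (s : nat -> bool) (i : nat) : nat :=
  count s (iota i.+1 (m + n - i)).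

Definition s_minus (s : nat -> bool) (i : nat) : nat :=
  count (predC s) (iota 1 i.-1).

Definition s_singular (s : nat -> bool) (M : glmn_data) (v : gl_V M) : Prop :=
  v != 0 /\ forall a b, (1 <= a)%N -> (a < b)%N -> (b <= m + n)%N ->
    gl_E M (sigma_s s a) (sigma_s s b) v = 0.

End Defs.

Section Polys.
Variable K : fieldType.
Variables (m n p : nat) (h : K) (z : 'I_p -> K).

Definition pshift (f : {poly K}) (c : int) : {poly K} :=
  f \Po ('X - (c%:~R * h)%:P).

(* T_i^s built from the s-highest weights mu k i = lambda_i^{(k,s)} and the sign s_i *)
Definition Tpoly (mu : 'I_p -> nat -> nat) (si : bool) (i : nat) : {poly K} :=
  \prod_(k < p) \prod_(1 <= j < (mu k i).+1)
     ('X - (z k)%:P + ((if si then 1 else -1) * j%:R * h)%:P).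

(* T_i = T_i^{s_0}: for s_0 the s_0-highest weight is lambda itself *)
Definition T0 (lam : 'I_p -> nat -> nat) (i : nat) : {poly K} :=
  Tpoly lam (i <= m)%N i.

Definition pi_poly (lam : 'I_p -> nat -> nat) (a b : nat) : {poly K} :=
  \prod_(k < p) \prod_(1 <= i < a.+1) \prod_(1 <= j < (minn b (lam k (m - i).+1)).+1)
     ('X - (z k)%:P + (((i + j)%:R - (a + b + 1)%:R) * h)%:P).

End Polys.

Definition h_generic (K : fieldType) (p : nat) (h : K) (z : 'I_p -> K) : Prop :=
  forall k l : 'I_p, k != l -> forall c : int, z k - z l != c%:~R * h.

(* Main.v *)
Require Import Defs.
From HB Require Import structures.
From mathcomp Require Import all_boot all_order all_algebra.
From mathcomp Require Import reals.
From mathcomp Require Import complex.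
From mathcomp Require Import zify ring.
Import Order.TTheory GRing.Theory Num.Theory.
Local Open Scope ring_scope.

(* In an irreducible module a singular vector for a total order on the indices
   1, ..., m+n is a highest weight vector for that order, so its weight is unique.
   Starting from the standard order, odd reflections produce singular vectors for all
   shuffles of 1 < ... < m with m+1 < ... < m+n: exchanging the adjacent indices a and
   m+j replaces v by e_{m+j,a} v if the weight mu of v has mu_a + mu_{m+j} <> 0 and keeps
   v otherwise. For a polynomial weight lambda the entries of the resulting weight are
   obtained by reading off the hook diagram of lambda: the entry at a is
   max (lambda_a - b, 0), where b odd indices precede a, and the entry at m+j is
   lambda_{m+j} plus the number of rows of length >= j among the even indices that
   m+j precedes. Both product formulas then hold tensor factor by tensor factor, by
   cancelling linear factors. *)

Set Implicit Arguments.
Unset Strict Implicit.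

(** * Singular vectors, uniqueness of their weights, and odd reflections *)

Section SingularVectors.
Variables (K : numFieldType) (m n : nat) (M : glmn_data K).
Hypothesis modM : is_glmn_module m n M.

Notation V := (gl_V M).
Notation E := (gl_E M).
Notation P := (gl_P M).
Notation range := (inrange m n).

Definition order_singular (lt : rel nat) (v : V) : Prop :=
  v != 0 /\ forall a b, range a -> range b -> lt a b -> E a b v = 0.

Definition has_weight (mu : nat -> K) (v : V) : Prop :=
  forall a, range a -> E a a v = mu a *: v.

Lemma supercommutator a b c d v :
  range a -> range b -> range c -> range d ->
  E a b (E c d v) =
    psign K ((ipar m a (+) ipar m b) && (ipar m c (+) ipar m d)) *: E c d (E a b v)
    + ((if b == c then E a d v else 0)
       - (if d == a
          then psign K ((ipar m a (+) ipar m b) && (ipar m c (+) ipar m d)) *: E c b v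
          else 0)).
Proof.
by move=> ra rb rc rd; case: modM => _ _ <- //; rewrite addrC subrK.
Qed.

Lemma psign_involutive (x : bool) (v : V) : psign K x *: (psign K x *: v) = v.
Proof. by rewrite scalerA /psign; case: x; rewrite ?mulrNN mulr1 scale1r. Qed.

Lemma gl_E_parity a b v : range a -> range b ->
  E a b (P v) = psign K (ipar m a (+) ipar m b) *: P (E a b v).
Proof. by case: modM => _ h _ ra rb; rewrite h // psign_involutive. Qed.

Lemma gl_E_diag_parity a v : range a -> E a a (P v) = P (E a a v).
Proof. by move=> ra; rewrite gl_E_parity // addbb scale1r. Qed.

(* U(n^-) v for the order lt; P v is added as a generator because v is not assumed
   to be homogeneous. *)
Inductive lower_span (lt : rel nat) (v : V) : V -> Prop :=
| lower_span_gen : lower_span lt v v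
| lower_span_parity : lower_span lt v (P v)
| lower_span0 : lower_span lt v 0
| lower_spanD x y : lower_span lt v x -> lower_span lt v y -> lower_span lt v (x + y)
| lower_spanZ c x : lower_span lt v x -> lower_span lt v (c *: x)
| lower_spanE a b x : range a -> range b -> lt b a ->
    lower_span lt v x -> lower_span lt v (E a b x).

Section Order.
Variable lt : rel nat.
Hypothesis lt_total :
  forall a b, range a -> range b -> [\/ lt a b, a = b | lt b a].

(** Induction on how the vector is generated. [supercommutator] moves an arbitrary [E a b] past a
    lowering operator, and every remaining term applies one operator to the shorter expression. On
    the generators [v] and [P v], totality of [lt] leaves only raising, diagonal or lowering
    operators. *)
Lemma lower_span_submodule v mu : order_singular lt v -> has_weight mu v ->
  is_graded_submodule m n (lower_span lt v).
Proof.
move=> [v0 vsing] vmu; split.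
- exact: lower_span0.
- exact: lower_spanD.
- exact: lower_spanZ.
- move=> x; elim=> {x}.
  + exact: lower_span_parity.
  + by case: modM => -> _ _; apply: lower_span_gen.
  + by rewrite linear0; apply: lower_span0.
  + by move=> x y _ hx _ hy; rewrite linearD; apply: lower_spanD.
  + by move=> c x _ hx; rewrite linearZ; apply: lower_spanZ.
  + move=> a b x ra rb ltba _ hx; case: modM => _ -> // _.
    by apply: lower_spanZ; apply: lower_spanE.
- move=> a b x + + hx; elim: hx a b => {x}.
  + move=> a b ra rb; case: (lt_total ra rb) => [lab|->|lba].
    * by rewrite vsing //; apply: lower_span0.
    * by rewrite vmu //; apply: lower_spanZ; apply: lower_span_gen.
    * by apply: lower_spanE => //; apply: lower_span_gen.
  + move=> a b ra rb; case: (lt_total ra rb) => [lab|->|lba].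
    * by rewrite gl_E_parity // vsing // linear0 scaler0; apply: lower_span0.
    * rewrite gl_E_diag_parity // vmu // linearZ.
      by apply: lower_spanZ; apply: lower_span_parity.
    * by apply: lower_spanE => //; apply: lower_span_parity.
  + by move=> a b _ _; rewrite linear0; apply: lower_span0.
  + move=> x y _ hx _ hy a b ra rb; rewrite linearD.
    by apply: lower_spanD; [apply: hx | apply: hy].
  + by move=> c x _ hx a b ra rb; rewrite linearZ; apply: lower_spanZ; apply: hx.
  + move=> c d x rc rd ltdc _ hx a b ra rb; rewrite supercommutator //.
    apply: lower_spanD.
      by apply: lower_spanZ; apply: lower_spanE => //; apply: hx.
    apply: lower_spanD; first by case: ifP => _; [apply: hx | apply: lower_span0].
    rewrite -scaleN1r; apply: lower_spanZ.
    by case: ifP => _; [apply: lower_spanZ; apply: hx | apply: lower_span0].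
Qed.

Section InitialSegment.
Variable U : pred nat.
Hypothesis initU : forall a b, range a -> range b -> lt a b -> U b -> U a.

(** A lowering operator can raise the eigenvalue of a single [E c c], but never that of the sum over
    an initial segment. This makes weights comparable by natural numbers. *)
Definition cartan_sum (x : V) : V := \sum_(c < m + n | U c.+1) E c.+1 c.+1 x.
Definition weight_sum (mu : nat -> K) : K := \sum_(c < m + n | U c.+1) mu c.+1.

Fact cartan_sum_is_linear : linear cartan_sum.
Proof.
move=> c x y; rewrite /cartan_sum scaler_sumr -big_split /=.
by apply: eq_bigr => i _; rewrite linearP.
Qed.
HB.instance Definition _ := GRing.isLinear.Build K V V *:%R cartan_sum
  cartan_sum_is_linear.

Lemma cartan_sum_weight mu v : has_weight mu v -> cartan_sum v = weight_sum mu *: v.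
Proof.
move=> vmu; rewrite /cartan_sum /weight_sum scaler_suml; apply: eq_bigr => i _.
by rewrite vmu // /inrange /= ltn_ord.
Qed.

Lemma sum_range_delta (a : nat) (x : V) : range a ->
  \sum_(c < m + n | U c.+1) (if c.+1 == a then x else 0) = if U a then x else 0.
Proof.
move=> ra; have la : (a.-1 < m + n)%N by move: ra; rewrite /inrange; lia.
have aE : (Ordinal la).+1 = a by move: ra; rewrite /inrange /=; lia.
rewrite big_mkcond (bigD1 (Ordinal la)) //= aE eqxx big1 ?addr0 // => c ca.
case: (c.+1 =P a) => [e|_]; last by rewrite if_same.
by case/eqP: ca; apply/val_inj => /=; lia.
Qed.

Lemma cartan_sum_lower a b x : range a -> range b ->
  cartan_sum (E a b x) =
  E a b (cartan_sum x) + ((if U a then E a b x else 0) - (if U b then E a b x else 0)).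
Proof.
move=> ra rb; rewrite -(sum_range_delta _ ra) -(sum_range_delta _ rb).
rewrite /cartan_sum linear_sum -sumrB -big_split /=; apply: eq_bigr => c _.
have rc : range c.+1 by rewrite /inrange /= ltn_ord.
rewrite supercommutator // addbb /= !scale1r (eq_sym b).
by case: (c.+1 =P a) => [<-|_]; case: (c.+1 =P b) => [<-|_].
Qed.

(** Kills the eigenvectors of [cartan_sum] whose eigenvalue lies [k] below the top value [S]. *)
Definition cartan_shift (S : K) (k : nat) (x : V) : V := cartan_sum x - (S - k%:R) *: x.

Fact cartan_shift_is_linear S k : linear (cartan_shift S k).
Proof.
move=> c x y; rewrite /cartan_shift linearP scalerDr !scalerA (mulrC _ c) -scalerA.
by rewrite opprD addrACA -scalerBr.
Qed.
HB.instance Definition _ S k := GRing.isLinear.Build K V V *:%R (cartan_shift S k)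
  (cartan_shift_is_linear S k).

Definition cartan_shifts (S : K) (l : seq nat) (x : V) : V :=
  foldr (cartan_shift S) x l.

Lemma cartan_shifts0 S l : cartan_shifts S l 0 = 0.
Proof. by elim: l => //= k l ->; rewrite linear0. Qed.

Lemma cartan_shiftsD S l x y :
  cartan_shifts S l (x + y) = cartan_shifts S l x + cartan_shifts S l y.
Proof. by elim: l => //= k l ->; rewrite linearD. Qed.

Lemma cartan_shiftsZ S l c x : cartan_shifts S l (c *: x) = c *: cartan_shifts S l x.
Proof. by elim: l => //= k l ->; rewrite linearZ. Qed.

Lemma cartan_shiftC S k l x :
  cartan_shift S k (cartan_shift S l x) = cartan_shift S l (cartan_shift S k x).
Proof.
rewrite /cartan_shift; move: (S - k%:R) (S - l%:R) => c d.
rewrite !linearB !linearZ /= !opprK !scalerN !scalerA (mulrC d) !addrA.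
by congr (_ + _); rewrite addrAC.
Qed.

Lemma cartan_shiftsC S l1 l2 x :
  cartan_shifts S l1 (cartan_shifts S l2 x) = cartan_shifts S l2 (cartan_shifts S l1 x).
Proof.
elim: l1 => //= k l1 ->; elim: l2 => //= k2 l2 <-.
by rewrite cartan_shiftC.
Qed.

(* Lowering operators decrease cartan_sum by 0 or 1 when U is an initial segment; an
   annihilating product of shifts replaces a decomposition into eigenvectors. *)
Lemma lower_span_annihilated v mu u :
  has_weight mu v -> lower_span lt v u ->
  exists l, cartan_shifts (weight_sum mu) l u = 0.
Proof.
move=> vmu; elim=> {u}.
- by exists [:: 0%N]; rewrite /= /cartan_shift (cartan_sum_weight vmu) subr0 subrr.
- have Pvmu : has_weight mu (P v).
    by move=> a ra; rewrite gl_E_diag_parity // vmu // linearZ.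
  by exists [:: 0%N]; rewrite /= /cartan_shift (cartan_sum_weight Pvmu) subr0 subrr.
- by exists [::].
- move=> x y _ [l1 h1] _ [l2 h2]; exists (l1 ++ l2).
  rewrite /cartan_shifts foldr_cat -!/(cartan_shifts _ _ _) cartan_shiftsD.
  by rewrite cartan_shiftsD h2 cartan_shiftsC h1 !cartan_shifts0 addr0.
- by move=> c x _ [l h]; exists l; rewrite cartan_shiftsZ h scaler0.
- move=> a b x ra rb ltba _ [l h].
  (* [E a b] drops the eigenvalue by [U b - U a], so each shift that serves for [x] moves down by
     this amount. The truncated subtraction is exact, because [U a] implies [U b]. *)
  exists [seq (k + (U b - U a))%N | k <- l].
  suff -> : cartan_shifts (weight_sum mu) [seq (k + (U b - U a))%N | k <- l] (E a b x)
            = E a b (cartan_shifts (weight_sum mu) l x) by rewrite h linear0.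
  elim: l {h} => //= k l ->.
  rewrite /cartan_shift cartan_sum_lower // [RHS]linearB [in RHS]linearZ /=.
  set y := E a b (cartan_shifts _ _ _); set S := weight_sum mu.
  have := initU rb ra ltba; case: (U a) => [/(_ isT) ->|_] /=.
    by rewrite subrr addr0 subnn addn0.
  case: (U b) => /=; last by rewrite subrr !addr0 addn0.
  rewrite natrD opprD !scalerDl !scaleNr scale1r !opprD !opprK sub0r -!addrA; congr (_ + _).
  by rewrite addrC !addrA addrK.
Qed.

Lemma cartan_shifts_weight S nu l w : has_weight nu w ->
  cartan_shifts S l w = \prod_(k <- l) (weight_sum nu - S + k%:R) *: w.
Proof.
move=> wnu; elim: l => [|k l IH]; first by rewrite big_nil scale1r.
rewrite /= IH linearZ big_cons /= /cartan_shift (cartan_sum_weight wnu).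
by rewrite -scalerBl scalerA mulrC opprB addrCA addrC addrAC.
Qed.

Hypothesis irrM : irreducible_glmn m n M.

Lemma weight_sum_le v w mu nu :
  order_singular lt v -> has_weight mu v -> w != 0 -> has_weight nu w ->
  exists k : nat, weight_sum mu = weight_sum nu + k%:R.
Proof.
move=> vsing vmu w0 wnu.
have [h|h] := irrM.2 _ (lower_span_submodule vsing vmu).
  by case: vsing; rewrite (h _ (lower_span_gen lt v)) eqxx.
have [l] := lower_span_annihilated vmu (h w).
rewrite (cartan_shifts_weight _ _ wnu) => /eqP; rewrite scaler_eq0 (negPf w0) orbF.
rewrite prodf_seq_eq0 => /hasP[k _ /= /eqP e]; exists k.
by apply/esym/eqP; rewrite -subr_eq0 addrAC e.
Qed.

Lemma weight_sum_unique v w mu nu :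
  order_singular lt v -> has_weight mu v -> order_singular lt w -> has_weight nu w ->
  weight_sum mu = weight_sum nu.
Proof.
move=> vs vmu ws wnu.
have [k e1] := weight_sum_le vs vmu ws.1 wnu.
have [l e2] := weight_sum_le ws wnu vs.1 vmu.
have /eqP: (l + k)%:R = 0 :> K.
  by apply: (addrI (weight_sum mu)); rewrite addr0 natrD addrA -e2.
by rewrite pnatr_eq0 addn_eq0 => /andP[_ /eqP k0]; rewrite e1 k0 addr0.
Qed.

End InitialSegment.

Hypothesis lt_irr : irreflexive lt.
Hypothesis lt_trans : forall a b c, range a -> range b -> range c ->
  lt a b -> lt b c -> lt a c.
Hypothesis irrM : irreducible_glmn m n M.

(** The entry at [a] is the difference of the weight sums over two initial segments, with and
    without [a]. Both sums are determined by [weight_sum_unique]. *)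
Lemma singular_weight_unique v w mu nu a :
  order_singular lt v -> has_weight mu v -> order_singular lt w -> has_weight nu w ->
  range a -> mu a = nu a.
Proof.
move=> vs vmu ws wnu ra.
pose U1 c := (c == a) || lt c a.
have i1 b c : range b -> range c -> lt b c -> U1 c -> U1 b.
  move=> rb rc lbc /orP[/eqP e|lca]; first by rewrite /U1 -e lbc orbT.
  by rewrite /U1 (lt_trans rb rc ra lbc lca) orbT.
have i2 b c : range b -> range c -> lt b c -> lt c a -> lt b a.
  by move=> rb rc; apply: lt_trans.
have := weight_sum_unique (U := U1) i1 irrM vs vmu ws wnu.
have := weight_sum_unique (U := lt^~ a) i2 irrM vs vmu ws wnu.
have split_sum f : weight_sum U1 f = f a + weight_sum (lt^~ a) f.
  have la : (a.-1 < m + n)%N by move: ra; rewrite /inrange; lia.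
  have aE : (Ordinal la).+1 = a by move: ra; rewrite /inrange /=; lia.
  rewrite /weight_sum (bigD1 (Ordinal la)) /= aE ?/U1 ?eqxx //; congr (_ + _).
  apply: eq_bigl => c; case: (c =P Ordinal la) => [->|ca]; first by rewrite aE lt_irr andbF.
  rewrite andbT; case: eqP => //= e.
  by case: ca; apply/val_inj => /=; lia.
by rewrite !split_sum => -> /addIr.
Qed.

(* Odd reflection in the simple root attached to the adjacent pair al, be. *)
Variables (lt' : rel nat) (al be : nat).
Hypotheses (ral : range al) (rbe : range be) (lt_al_be : lt al be).
Hypothesis odd_root : ipar m al (+) ipar m be.
Hypothesis below : forall c, range c -> lt c be -> c = al \/ lt c al.
Hypothesis above : forall c, range c -> lt al c -> c = be \/ lt be c.
Hypothesis lt'E : forall a b, range a -> range b -> lt' a b ->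
  (a = be /\ b = al) \/ (lt a b /\ ~ (a = al /\ b = be)).

Let al_be : al != be.
Proof. by apply: contraTneq lt_al_be => ->; rewrite lt_irr. Qed.

Lemma odd_lower_square v : E be al (E be al v) = 0.
Proof.
have oo : ipar m be (+) ipar m al by rewrite addbC.
have := supercommutator v rbe ral rbe ral.
rewrite oo /= (negPf al_be) subr0 addr0 scaleN1r => /eqP; rewrite -addr_eq0.
by rewrite -mulr2n -scaler_nat scaler_eq0 pnatr_eq0 => /eqP.
Qed.

(** The supercommutator leaves only [E a al] when [b = be] and [E be b] when [a = al]. Adjacency of
    [al] and [be] makes both raising operators, so they kill [v]. *)
Lemma odd_lower_raise v a b : order_singular lt v -> range a -> range b ->
  lt a b -> ~ (a = al /\ b = be) -> E a b (E be al v) = 0.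
Proof.
move=> [_ vs] ra rb lab nab; rewrite supercommutator // (vs a b) // linear0 scaler0 add0r.
case: (b =P be) => [e|_]; case: (al =P a) => [e'|_].
- by case: nab.
- subst b; case: (below ra lab) => [e''|l]; first by case: nab.
  by rewrite vs // subr0.
- subst a; case: (above rb lab) => [e''|l]; first by case: nab.
  by rewrite (vs be b) // scaler0 subr0.
- by rewrite subr0.
Qed.

Lemma odd_lower_weight v mu : has_weight mu v ->
  has_weight (fun c => mu c + (c == be)%:R - (c == al)%:R) (E be al v).
Proof.
move=> vmu c rc; rewrite supercommutator // addbb /= !scale1r vmu // linearZ /=.
rewrite scalerDl scalerDl scaleNr !scaler_nat (eq_sym al) -addrA; congr (_ + (_ - _)).
  by case: (c =P be) => [->|].
by case: (c =P al) => [->|].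
Qed.

Lemma odd_raise_lower v mu : order_singular lt v -> has_weight mu v ->
  E al be (E be al v) = (mu al + mu be) *: v.
Proof.
move=> [_ vs] vmu; rewrite supercommutator // (vs al be) // linear0 scaler0 add0r !eqxx.
have oo : ipar m be (+) ipar m al by rewrite addbC.
by rewrite odd_root oo /= scaleN1r opprK !vmu // scalerDl.
Qed.

Lemma odd_reflection_typical v mu : order_singular lt v -> has_weight mu v ->
  mu al + mu be != 0 -> order_singular lt' (E be al v).
Proof.
move=> vs vmu nz; split.
  apply: contraNneq nz => e; have := odd_raise_lower vs vmu.
  by rewrite e linear0 => /esym/eqP; rewrite scaler_eq0 (negPf vs.1) orbF.
move=> a b ra rb /(lt'E ra rb)[[-> ->]|[lab nab]]; first exact: odd_lower_square.
exact: odd_lower_raise.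
Qed.

(* Otherwise the lowered vector would be singular for lt of a different weight. *)
Lemma odd_reflection_atypical v mu : order_singular lt v -> has_weight mu v ->
  mu al + mu be = 0 -> order_singular lt' v.
Proof.
move=> vs vmu z; split; first by case: vs.
move=> a b ra rb /(lt'E ra rb)[[-> ->]|[lab nab]]; last by apply: vs.2.
apply/eqP/negPn/negP => fv0.
have fvs : order_singular lt (E be al v).
  split=> // c d rc rd lcd.
  case: (c =P al) => [ca|ca]; last by apply: odd_lower_raise => // -[].
  case: (d =P be) => [db|db]; last by apply: odd_lower_raise => // -[].
  by rewrite ca db (odd_raise_lower vs vmu) z scale0r.
have := singular_weight_unique vs vmu fvs (odd_lower_weight vmu) ral.
rewrite eqxx (negPf al_be) addr0 => /eqP.
by rewrite -subr_eq0 opprB addrCA subrr addr0 oner_eq0.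
Qed.

End Order.
End SingularVectors.

(** * Shuffle orders and their hook weights *)

Section Shuffles.
Variables m n : nat.
Local Open Scope nat_scope.

(* A shuffle of 1 < ... < m with m+1 < ... < m+n is encoded by b: the entry a <= m is
   preceded by exactly m+1, ..., m + b a. *)
Definition shuffle_lt (b : nat -> nat) : rel nat := fun c d =>
  if c <= m then (if d <= m then c < d else b c < d - m)
  else (if d <= m then c - m <= b d else c < d).

Definition is_shuffle (b : nat -> nat) : Prop :=
  (forall a a', 0 < a -> a <= a' -> a' <= m -> b a <= b a') /\
  (forall a, 0 < a -> a <= m -> b a <= n).

Definition shuffle_weight (lam b : nat -> nat) (c : nat) : nat :=
  if c <= m then lam c - b c
  else lam c + \sum_(i < m) (c - m <= minn (b i.+1) (lam i.+1)).

(** With [b] read as a diagram of row lengths, deleting the last box of row [a] undoes the exchange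
    of the adjacent indices [a] and [m + b a]. *)
Definition remove_box (b : nat -> nat) (a : nat) : nat -> nat :=
  fun x => if x == a then (b a).-1 else b x.

Lemma shuffle_lt_irr b : irreflexive (shuffle_lt b).
Proof. by move=> c; rewrite /shuffle_lt; case: (c <= m); rewrite ltnn. Qed.

Lemma shuffle_lt_total b a c : inrange m n a -> inrange m n c ->
  [\/ shuffle_lt b a c, a = c | shuffle_lt b c a].
Proof.
rewrite /inrange => ra rc; case: (ltngtP a c) => [lac|lca|->]; last by constructor 2.
- rewrite /shuffle_lt; case: (leqP a m) => am; case: (leqP c m) => cm.
  + by constructor 1.
  + by case: (ltnP (b a) (c - m)) => h; [constructor 1 | constructor 3].
  + lia.
  + by constructor 1.
- rewrite /shuffle_lt; case: (leqP a m) => am; case: (leqP c m) => cm.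
  + by constructor 3.
  + lia.
  + by case: (ltnP (b c) (a - m)) => h; [constructor 3 | constructor 1].
  + by constructor 3.
Qed.

Lemma shuffle_lt_trans b : is_shuffle b -> forall x y z,
  inrange m n x -> inrange m n y -> inrange m n z ->
  shuffle_lt b x y -> shuffle_lt b y z -> shuffle_lt b x z.
Proof.
move=> [mono _] x y z; rewrite /inrange /shuffle_lt => rx ry rz.
case: (leqP x m) => xm; case: (leqP y m) => ym; case: (leqP z m) => zm.
- exact: ltn_trans.
- by move=> xy; apply: leq_ltn_trans; apply: mono => //; lia.
- move=> bx yb; case: (ltnP x z) => // zx.
  have := mono z x; lia.
- by move=> bx yz; lia.
- by move=> xb yz; apply: leq_trans xb _; apply: mono => //; lia.
- by move=> xb bz; lia.
- by move=> xy yb; lia.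
- exact: ltn_trans.
Qed.

Lemma sum_change1 (F G : nat -> nat) a : 0 < a <= m ->
  (forall i, i != a -> F i = G i) ->
  \sum_(i < m) F i.+1 + G a = \sum_(i < m) G i.+1 + F a.
Proof.
case: a => [//|a] am FG.
rewrite (bigD1 (Ordinal am)) //= [in RHS](bigD1 (Ordinal am)) //=.
rewrite (eq_bigr (fun i : 'I_m => (G i.+1))); last by move=> i ia; apply: FG.
by rewrite addnAC [RHS]addnAC (addnC (F _)).
Qed.

(** Monotonicity could fail only against a row before [a], and those rows are empty. *)
Lemma remove_box_shuffle b a : is_shuffle b -> 0 < a <= m ->
  (forall c, 0 < c -> c < a -> b c = 0) -> is_shuffle (remove_box b a).
Proof.
move=> [mono bn] am b0; split=> [c d c0 cd dm|c c0 cm]; rewrite /remove_box.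
  case: (c =P a) => ca; case: (d =P a) => da //; last exact: mono.
    by apply: leq_trans (leq_pred _) _; apply: mono => //; lia.
  by rewrite b0 //; lia.
by have := bn _ c0 cm; case: (c =P a) => [->|_]; lia.
Qed.

Lemma poly_weight_le lam c d : poly_weight m n lam ->
  0 < c -> c <= d -> d <= m -> lam d <= lam c.
Proof.
case=> h _ _ c0 cd; rewrite -(subnKC cd); elim: (d - c) => [|k IH] km.
  by rewrite addn0.
apply: leq_trans (IH _); last by lia.
by rewrite addnS; apply: h; lia.
Qed.

Lemma poly_weight_hook lam j : poly_weight m n lam ->
  j <= n -> 0 < m -> lam m < j -> lam (m + j) = 0.
Proof. by case=> _ _ h jn m0 mj; apply: h. Qed.

Variables (lam b : nat -> nat) (a : nat).
Hypothesis am : 0 < a <= m.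
Hypothesis ba : 0 < b a.

(** This is the weight change of a typical odd reflection. Since [b a <= lam a], row [a] counts
    towards the entry at [m + b a] for [b] but not after the box is removed. Indicators stand on
    both sides to avoid truncated subtraction. *)
Lemma shuffle_weight_add_box c : b a <= lam a ->
  shuffle_weight lam (remove_box b a) c + (c == m + b a)
  = shuffle_weight lam b c + (c == a).
Proof.
move=> jl; rewrite /shuffle_weight; case: (leqP c m) => cm.
  have -> : (c == m + b a) = false by lia.
  by rewrite /remove_box; case: (c =P a) => [->|_]; lia.
have -> : (c == a) = false by lia.
rewrite addn0 -addnA; congr addn.
pose F b' i : nat := c - m <= minn (b' i) (lam i).
have FE i : i != a -> F (remove_box b a) i = F b i by rewrite /F /remove_box => /negPf->.
have := sum_change1 am FE; rewrite /F {2}/remove_box eqxx.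
by case: (c =P m + b a) => ca; lia.
Qed.
End Shuffles.

(** * Adjacency of [a] and [m + b a], as odd reflections require *)

Section AddBox.
Variables (m n : nat) (b : nat -> nat) (a : nat).
Local Open Scope nat_scope.
Hypothesis shb : is_shuffle m n b.
Hypothesis am : 0 < a <= m.
Hypothesis ba : 0 < b a.

Lemma remove_box_lt : shuffle_lt m (remove_box b a) a (m + b a).
Proof.
rewrite /shuffle_lt /remove_box eqxx addKn.
have -> : a <= m by lia.
have -> : (m + b a <= m) = false by lia.
by rewrite prednK.
Qed.

Lemma remove_box_below c : inrange m n c -> shuffle_lt m (remove_box b a) c (m + b a) ->
  c = a \/ shuffle_lt m (remove_box b a) c a.
Proof.
rewrite /inrange /shuffle_lt => rc; have -> : (m + b a <= m) = false by lia.
have -> : a <= m by lia.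
rewrite /remove_box eqxx addKn; case: (leqP c m) => cm; last by lia.
case: (c =P a) => [->|ca]; first by left.
move=> bc; right; rewrite ltnNge; apply/negP => ac.
have : b a <= b c by case: shb => mono _; apply: mono => //; lia.
lia.
Qed.

Lemma remove_box_above c : inrange m n c -> shuffle_lt m (remove_box b a) a c ->
  c = m + b a \/ shuffle_lt m (remove_box b a) (m + b a) c.
Proof.
rewrite /inrange /shuffle_lt => rc; have -> : (m + b a <= m) = false by lia.
have -> : a <= m by lia.
rewrite /remove_box eqxx addKn; case: (leqP c m) => cm; last by lia.
case: (c =P a) => [->|ca]; first by rewrite ltnn.
by move=> ac; right; case: shb => mono _; apply: mono => //; lia.
Qed.

Lemma add_box_lt x y : inrange m n x -> inrange m n y -> shuffle_lt m b x y ->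
  (x = m + b a /\ y = a) \/
  (shuffle_lt m (remove_box b a) x y /\ ~ (x = a /\ y = m + b a)).
Proof.
rewrite /inrange /shuffle_lt /remove_box => rx ry.
case: (leqP x m) => xm; case: (leqP y m) => ym.
- by move=> xy; right; split => //; lia.
- case: (x =P a) => [->|xa] h; right; split; lia.
- case: (y =P a) => [->|ya] h; last by right; split => //; lia.
  case: (x =P m + b a) => xe; first by left.
  by right; split; lia.
- by move=> xy; right; split => //; lia.
Qed.

End AddBox.

(** * Singular vectors for all shuffles of a polynomial weight *)

Section ShuffleWeights.
Variables (K : numFieldType) (m n : nat) (M : glmn_data K) (lam : nat -> nat).
Hypotheses (modM : is_glmn_module m n M) (irrM : irreducible_glmn m n M).
Hypotheses (lamP : poly_weight m n lam) (hwM : has_highest_weight m n M lam).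

Notation wt b := (fun c => (shuffle_weight m lam b c)%:R : K).

Lemma shuffle_lt0 (b : nat -> nat) x y : (forall a, (0 < a <= m)%N -> b a = 0%N) ->
  inrange m n x -> inrange m n y -> shuffle_lt m b x y -> (x < y)%N.
Proof.
rewrite /inrange /shuffle_lt => b0 rx ry.
by case: (leqP x m) => xm; case: (leqP y m) => ym //; rewrite ?b0; lia.
Qed.

Lemma shuffle_weight0 (b : nat -> nat) c : (forall a, (0 < a <= m)%N -> b a = 0%N) ->
  inrange m n c -> shuffle_weight m lam b c = lam c.
Proof.
rewrite /inrange /shuffle_weight => b0 rc; case: (leqP c m) => cm.
  by rewrite b0 ?subn0 //; lia.
by rewrite big1 ?addn0 // => i _; rewrite b0 ?ltn_ord // min0n leqn0 subn_eq0 leqNgt cm /=.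
Qed.

(** Induction on the number of boxes of [b]. The empty diagram is the standard order, and each
    further box is one odd reflection, typical exactly when the box lies inside the diagram of
    [lam]. *)
Lemma shuffle_singular_exists (b : nat -> nat) : is_shuffle m n b ->
  exists v : gl_V M,
    order_singular m n (shuffle_lt m b) v /\ has_weight m n (wt b) v.
Proof.
have [N leN] := ubnP (\sum_(i < m) b i.+1)%N; elim: N b leN => // N IH b leN shb.
case: (boolP [exists i : 'I_m, 0 < b i.+1]%N) => [/existsP[i bi]|/existsPn none]; last first.
  have b0 a : (0 < a <= m)%N -> b a = 0%N.
    by case: a => // a am; have := none (Ordinal am); rewrite lt0n negbK => /eqP.
  case: hwM => v [v0 vs vw]; exists v; split; first split=> // x y rx ry xy.
    apply: vs; [by case/andP: rx | exact: shuffle_lt0 xy | by case/andP: ry].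
  by move=> c rc; rewrite vw // shuffle_weight0.
have ex : exists a, (0 < a <= m)%N && (0 < b a)%N by exists i.+1; rewrite /= ltn_ord.
(* The first nonempty row is chosen so that removing its last box leaves a shuffle. *)
case: (ex_minnP ex) => a /andP[am ba] amin.
have b0 c : (0 < c)%N -> (c < a)%N -> b c = 0%N.
  move=> c0 ca; apply/eqP; rewrite -leqn0 leqNgt; apply/negP => bc.
  by have := amin c; rewrite bc c0 /=; lia.
have shb' := remove_box_shuffle shb am b0.
have {}IH := IH (remove_box b a) _ shb'.
have {IH}[|v [vs vw]] := IH.
  have rbE c : c != a -> remove_box b a c = b c by rewrite /remove_box => /negPf->.
  have := sum_change1 am rbE; rewrite {2}/remove_box eqxx.
  by move: leN; move: (\sum_(j < m) b j.+1)%N (\sum_(j < m) _)%N => S S'; lia.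
have ran : inrange m n a by rewrite /inrange; lia.
have bn : (b a <= n)%N by case: shb => _; apply; lia.
have rbe : inrange m n (m + b a) by rewrite /inrange; lia.
have odd_root : ipar m a (+) ipar m (m + b a).
  have -> : ipar m a = false by rewrite /ipar; lia.
  by rewrite /ipar; lia.
have ltt := @shuffle_lt_total m n (remove_box b a).
have lti := @shuffle_lt_irr m (remove_box b a).
have lttr := shuffle_lt_trans shb'.
have lab := remove_box_lt am ba.
have blw := @remove_box_below m n b a shb am ba.
have abv := @remove_box_above m n b a shb am ba.
have lt'E := @add_box_lt m n b a am ba.
case: (leqP (b a) (lam a)) => jl.
  have wE := fun c => shuffle_weight_add_box am ba c jl.
  exists (gl_E M (m + b a) a v); split.
    apply: (odd_reflection_typical modM lti ran rbe lab odd_root blw abv lt'E vs vw).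
    rewrite -natrD pnatr_eq0 {1}/shuffle_weight; have -> : (a <= m)%N by lia.
    by rewrite /remove_box eqxx; lia.
  move=> c rc; rewrite (odd_lower_weight modM ran rbe vw) //; congr (_ *: _).
  by rewrite -natrD wE natrD addrK.
(* Atypical case [lam a < b a]: the hook condition gives [lam (m + b a) = 0], rows from [a] on are
   too short for column [b a], and earlier rows have [b = 0]. So both weight entries vanish and the
   box changes no weight. *)
have m0 : (0 < m)%N by lia.
have hook := poly_weight_hook lamP bn m0.
have lama c : (a <= c)%N -> (c <= m)%N -> (lam c <= lam a)%N.
  by move=> ac cm; apply: (poly_weight_le lamP) ac cm; case/andP: am.
have wE c : shuffle_weight m lam (remove_box b a) c = shuffle_weight m lam b c.
  rewrite /shuffle_weight /remove_box; case: (leqP c m) => cm.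
    by case: (c =P a) => [->|//]; lia.
  congr addn; apply: eq_bigr => j _; case: (j.+1 =P a) => [->|//].
  by congr nat_of_bool; lia.
exists v; split; last by move=> c rc; rewrite vw // wE.
apply: (odd_reflection_atypical modM ltt lti lttr irrM ran rbe lab
           odd_root blw abv lt'E vs vw).
rewrite -natrD /shuffle_weight; have -> : (a <= m)%N by lia.
have -> : (m + b a <= m)%N = false by lia.
rewrite /remove_box eqxx hook ?big1 ?addn0; last by have := lama m; lia.
  by have -> : (lam a - (b a).-1 = 0)%N by lia.
move=> j _; case: (j.+1 =P a) => [->|ja]; first by rewrite addKn; lia.
case: (ltnP j.+1 a) => jal; first by rewrite (b0 j.+1) // addKn; lia.
by have := lama j.+1; have := ltn_ord j; rewrite addKn; lia.
Qed.

Lemma singular_shuffle_weight (b : nat -> nat) (mu : nat -> nat) (v : gl_V M) c :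
  is_shuffle m n b -> order_singular m n (shuffle_lt m b) v ->
  has_weight m n (fun c => (mu c)%:R : K) v -> inrange m n c ->
  mu c = shuffle_weight m lam b c.
Proof.
move=> shb vs vmu rc; have [w [ws wb]] := shuffle_singular_exists shb.
apply/eqP; rewrite -(eqr_nat K); apply/eqP.
exact: (singular_weight_unique modM (@shuffle_lt_total m n b) (@shuffle_lt_irr m b)
          (shuffle_lt_trans shb) irrM vs vmu ws wb rc).
Qed.

End ShuffleWeights.

(** * From parity sequences to shuffles *)

Section ParitySequences.
Variables (m n : nat) (s : nat -> bool).
Local Open Scope nat_scope.

Notation ones i := (count s (iota 1 i)).
Notation minuses i := (count (predC s) (iota 1 i)).

(* The number of entries -1 before the a-th entry 1 of s, written without reference to
   the position of that entry. *)
Definition shuffle_of (a : nat) : nat :=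
  count (fun t => ~~ s t && (ones t < a)) (iota 1 (m + n)).

Lemma count_iotaS (p : pred nat) i :
  count p (iota 1 i.+1) = count p (iota 1 i) + p i.+1.
Proof. by rewrite -(addn1 i) iotaD count_cat /= addn0 (addnC 1). Qed.

Lemma count_iota_le (p : pred nat) i j : i <= j ->
  count p (iota 1 i) <= count p (iota 1 j).
Proof. by move=> ij; rewrite -(subnKC ij) iotaD count_cat leq_addr. Qed.

Lemma count_iota_surj (p : pred nat) N a : 0 < a <= count p (iota 1 N) ->
  exists i, [/\ 0 < i <= N, p i & count p (iota 1 i) = a].
Proof.
elim: N => [|N IH]; first by rewrite /=; lia.
case: (leqP a (count p (iota 1 N))) => [aN /andP[a0 _]|Na].
  have [|i [iN pi e]] := IH; first by rewrite a0.
  by exists i; split=> //; lia.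
rewrite count_iotaS => aN; exists N.+1; split; first lia; last by rewrite count_iotaS; lia.
by case: (p N.+1) aN => //; lia.
Qed.

Lemma ones_minuses i : ones i + minuses i = i.
Proof. by rewrite count_predC size_iota. Qed.

Lemma shuffle_of_take i a : 0 < i <= m + n -> a <= ones i ->
  shuffle_of a = count (fun t => ~~ s t && (ones t < a)) (iota 1 i.-1).
Proof.
move=> imn ai; rewrite /shuffle_of; have -> : m + n = i.-1 + (m + n - i.-1) by lia.
rewrite iotaD count_cat; set c := (X in _ + X); suff -> : c = 0 by rewrite addn0.
apply/eqP; rewrite -leqn0 leqNgt -has_count; apply/hasPn => t; rewrite mem_iota => ti.
have := @count_iota_le s i t; rewrite negb_and negbK -leqNgt => h.
by rewrite (leq_trans ai) ?orbT // h //; lia.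
Qed.

Lemma shuffle_of_le i a : 0 < i <= m + n -> a <= ones i -> shuffle_of a <= minuses i.-1.
Proof.
by move=> imn ai; rewrite (shuffle_of_take imn ai); apply: sub_count => t /andP[].
Qed.

Lemma shuffle_of_one i : 0 < i <= m + n -> s i -> shuffle_of (ones i) = minuses i.-1.
Proof.
move=> imn si; rewrite (shuffle_of_take imn (leqnn _)); apply: eq_in_count => t.
rewrite mem_iota => ti; have := @count_iota_le s t i.-1.
have := count_iotaS s i.-1; rewrite prednK ?si /=; last by case/andP: imn.
by move=> -> h; rewrite addn1 ltnS h ?andbT //; lia.
Qed.

(** If [ones i < a], every entry -1 up to position [i] is counted by [shuffle_of a]. Otherwise only
    entries before [i] are, and the one at [i] is missing. *)
Lemma shuffle_of_minus i a : 0 < i <= m + n -> ~~ s i ->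
  (minuses i <= shuffle_of a) = (ones i < a).
Proof.
move=> imn si; case: (ltnP (ones i) a) => ia; last first.
  apply/negbTE; rewrite -ltnNge; apply: leq_ltn_trans (shuffle_of_le imn ia) _.
  have := count_iotaS (predC s) i.-1; rewrite prednK /= ?(negPf si); last by case/andP: imn.
  by move=> ->; rewrite addn1.
rewrite /shuffle_of; have -> : m + n = i + (m + n - i) by lia.
rewrite iotaD count_cat; apply: leq_trans (leq_addr _ _).
rewrite leq_eqVlt; apply/orP; left; apply/eqP/eq_in_count => t; rewrite mem_iota => ti.
by rewrite (leq_ltn_trans _ ia) ?andbT //; apply: count_iota_le; lia.
Qed.

Hypothesis parity_s : parity_seq m n s.

Lemma minuses_all : minuses (m + n) = n.
Proof. by have := ones_minuses (m + n); rewrite parity_s => /addnI. Qed.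

Lemma shuffle_of_is_shuffle : is_shuffle m n shuffle_of.
Proof.
split=> [a c _ ac _|a _ _].
  by apply: sub_count => t /andP[st ta]; rewrite st (leq_trans ta ac).
by rewrite -[leqRHS]minuses_all; apply: sub_count => t /andP[].
Qed.

Lemma sigma_s_one i : 0 < i <= m + n -> s i -> 0 < ones i <= m.
Proof.
move=> imn si; rewrite -{1}parity_s count_iota_le; last by case/andP: imn.
by case: i imn si => // i _ si; rewrite count_iotaS si addn1.
Qed.

Lemma sigma_s_minus i : 0 < i <= m + n -> ~~ s i -> 0 < minuses i <= n.
Proof.
move=> imn si; rewrite -{1}minuses_all count_iota_le; last by case/andP: imn.
by case: i imn si => // i _ si; rewrite count_iotaS /= (negPf si) addn1.
Qed.

Lemma s_plusE i : i <= m + n -> s_plus m n s i = m - ones i.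
Proof.
move=> imn; have := parity_s; rewrite /parity_seq -{1}(subnKC imn) iotaD count_cat add1n.
by move=> e; rewrite -[in RHS]e addKn.
Qed.

Lemma sigma_s_range i : inrange m n i -> inrange m n (sigma_s m s i).
Proof.
rewrite /inrange /sigma_s => imn.
by case: ifP => [/(sigma_s_one imn)|/negbT/(sigma_s_minus imn)]; lia.
Qed.

Lemma sigma_s_surj c : inrange m n c -> exists2 i, inrange m n i & sigma_s m s i = c.
Proof.
rewrite /inrange /sigma_s => cmn; case: (leqP c m) => cm.
  have [|i [imn si <-]] := @count_iota_surj s (m + n) c; first by rewrite parity_s; lia.
  by exists i => //; rewrite si.
have [|i [imn si e]] := @count_iota_surj (predC s) (m + n) (c - m).
  by rewrite minuses_all; lia.
by exists i => //; rewrite (negPf si) e subnKC // ltnW.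
Qed.

Lemma sigma_s_shuffle_lt i j : inrange m n i -> inrange m n j -> i < j ->
  shuffle_lt m shuffle_of (sigma_s m s i) (sigma_s m s j).
Proof.
rewrite /inrange => imn jmn ij; rewrite /shuffle_lt /sigma_s.
have jS p : count p (iota 1 j) = count p (iota 1 j.-1) + p j.
  by rewrite -[in LHS](ltn_predK ij) count_iotaS (ltn_predK ij).
have gt_m k : 0 < k <= n -> (m + k <= m) = false by lia.
case: (boolP (s i)) => si; case: (boolP (s j)) => sj.
- have /andP[_ ->] := sigma_s_one imn si; have /andP[_ ->] := sigma_s_one jmn sj.
  by rewrite (jS s) sj addn1 ltnS count_iota_le //; lia.
- have /andP[_ ->] := sigma_s_one imn si; rewrite (gt_m _ (sigma_s_minus jmn sj)).
  rewrite addKn (shuffle_of_one imn si) (jS (predC s)) /= (negPf sj) addn1 ltnS.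
  by rewrite count_iota_le //; lia.
- have /andP[_ ->] := sigma_s_one jmn sj; rewrite (gt_m _ (sigma_s_minus imn si)).
  by rewrite addKn (shuffle_of_one jmn sj) count_iota_le //; lia.
- rewrite (gt_m _ (sigma_s_minus imn si)) (gt_m _ (sigma_s_minus jmn sj)).
  by rewrite ltn_add2l (jS (predC s)) /= (negPf sj) addn1 ltnS count_iota_le //; lia.
Qed.

(** The reverse inequality of positions would, by [sigma_s_shuffle_lt] and transitivity, put an
    index before itself. *)
Lemma sigma_s_shuffle_lt_inv i j : inrange m n i -> inrange m n j ->
  shuffle_lt m shuffle_of (sigma_s m s i) (sigma_s m s j) -> i < j.
Proof.
move=> imn jmn lt_ij; case: (ltngtP i j) => // [ji|ij]; last first.
  by move: lt_ij; rewrite ij shuffle_lt_irr.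
have := shuffle_lt_trans shuffle_of_is_shuffle (sigma_s_range imn) (sigma_s_range jmn)
  (sigma_s_range imn) lt_ij (sigma_s_shuffle_lt jmn imn ji).
by rewrite shuffle_lt_irr.
Qed.

Lemma s_singular_order (K : numFieldType) (M : glmn_data K) (v : gl_V M) :
  s_singular m n s v -> order_singular m n (shuffle_lt m shuffle_of) v.
Proof.
move=> [v0 vs]; split=> // a c ra rc.
have [i imn <-] := sigma_s_surj ra; have [j jmn <-] := sigma_s_surj rc.
move=> /(sigma_s_shuffle_lt_inv imn jmn) ij; move: imn jmn; rewrite /inrange => imn jmn.
by apply: vs => //; [case/andP: imn | case/andP: jmn].
Qed.

Lemma shuffle_weight_one lam i : inrange m n i -> s i ->
  shuffle_weight m lam shuffle_of (sigma_s m s i) = lam (sigma_s m s i) - s_minus s i.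
Proof.
move=> imn si; rewrite /shuffle_weight /sigma_s si.
by have /andP[_ ->] := sigma_s_one imn si; rewrite shuffle_of_one.
Qed.

Lemma s_minusE i : 0 < i -> ~~ s i -> minuses i = (s_minus s i).+1.
Proof. by case: i => // i _ si; rewrite count_iotaS /= (negPf si) addn1. Qed.

(** Only the last [A] even indices come after position [i]. Their rows are numbered from the bottom
    of the diagram, as [hook_column_prod] expects. *)
Lemma shuffle_weight_minus lam i (A := s_plus m n s i) : inrange m n i -> ~~ s i ->
  shuffle_weight m lam shuffle_of (sigma_s m s i) =
  lam (sigma_s m s i) + \sum_(1 <= a < A.+1) (s_minus s i < lam (m - (A.+1 - a)).+1).
Proof.
move=> imn si; rewrite /shuffle_weight /sigma_s (negPf si).
have i0 : 0 < i by case/andP: imn.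
have im : i <= m + n by case/andP: imn.
case: leqP => [|_]; first by have := sigma_s_minus imn si; lia.
have om : ones i <= m by rewrite -{1}parity_s count_iota_le.
congr addn; rewrite addKn /A (s_plusE im).
rewrite -(big_mkord xpredT (fun j => minuses i <= minn (shuffle_of j.+1) (lam j.+1) : nat)).
rewrite (big_cat_nat _ om) //= big1_seq ?add0n; last first.
  by move=> j /=; rewrite mem_index_iota leq_min (shuffle_of_minus _ imn si); lia.
rewrite -{1}[ones i]add0n big_addn big_add1 /=; apply: eq_big_nat => j jm.
rewrite leq_min (shuffle_of_minus _ imn si) (s_minusE i0 si).
have -> : ones i < (j + ones i).+1 by lia.
by have -> : m - ((m - ones i).+1 - j.+1) = j + ones i by lia.
Qed.

End ParitySequences.

(** * Cancellation of factors, with row lengths [l] read from the bottom *)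

Section HookProducts.
Variables (R : comPzRingType) (F : int -> R) (A B L : nat) (l : nat -> nat).

(** The shift by 1 matches the first [A] rows on both sides. The extra row [A.+1] contributes
    [F (j - B)] for [j] up to [minn B (l A.+1)], which is the missing initial part of the product on
    the right. *)
Lemma hook_row_prod :
  (\prod_(1 <= j < (l A.+1 - B).+1) F j%:Z) *
    \prod_(1 <= i < A.+2) \prod_(1 <= j < (minn B (l i)).+1)
       F ((i + j)%:Z - (A.+1 + B + 1)%:Z + 1) =
  (\prod_(1 <= j < (l A.+1).+1) F (j%:Z - B%:Z)) *
    \prod_(1 <= i < A.+1) \prod_(1 <= j < (minn B (l i)).+1)
       F ((i + j)%:Z - (A + B + 1)%:Z).
Proof.
rewrite (@big_nat_recr _ _ _ A.+1) //= mulrA mulrAC; congr (_ * _); last first.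
  apply: eq_bigr => i _; apply: eq_bigr => j _; congr F; lia.
rewrite mulrC [RHS](@big_cat_nat _ _ _ (minn B (l A.+1)).+1) //=; last by lia.
congr (_ * _); first by apply: eq_bigr => j _; congr F; lia.
case: (leqP (l A.+1) B) => h.
  by rewrite (eqP h) !big_geq.
rewrite -[in RHS](add1n B) big_addn subSn; last exact: ltnW.
by apply: eq_bigr => j _; congr F; lia.
Qed.

Lemma prod_prefix (q : nat -> bool) (G : nat -> R) :
  (forall i j, (0 < i)%N -> (i <= j)%N -> (j <= A)%N -> q j -> q i) ->
  \prod_(1 <= i < A.+1) (if q i then G i else 1) =
  \prod_(1 <= i < (\sum_(1 <= i < A.+1) q i).+1) G i.
Proof.
elim: A => [|a IH] down; first by rewrite [in RHS]big_geq // !big_geq.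
case: (boolP (q a.+1)) => qa.
  have qT i : (1 <= i < a.+2)%N -> q i = true.
    by case/andP=> i0 ia; apply: down qa.
  rewrite (eq_big_nat _ _ (F2 := fun=> 1%N)); last by move=> i /qT ->.
  rewrite sum_nat_const_nat muln1 subn1 /=.
  by apply: eq_big_nat => i /qT ->.
rewrite !(@big_nat_recr _ _ _ a.+1) //= (negPf qa) mulr1 addn0; apply: IH.
by move=> i j i0 ij ja; apply: down => //; lia.
Qed.

(** Passing from [B] to [B.+1] adds the factor [F (i - A.+1)] for each row longer than [B]. These
    are the rows of largest [i], so reversing the order yields [F (-1)], [F (-2)] and so on, as many
    as there are such rows. *)
Lemma hook_column_prod :
  (forall i j, (0 < i)%N -> (i <= j)%N -> (j <= A)%N -> (l i <= l j)%N) ->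
  ((0 < L)%N -> forall i, (0 < i <= A)%N -> (B < l i)%N) ->
  (\prod_(1 <= j < (L + \sum_(1 <= a < A.+1) (B < l (A.+1 - a))).+1) F (- j%:Z)) *
    \prod_(1 <= i < A.+1) \prod_(1 <= j < (minn B (l i)).+1)
       F ((i + j)%:Z - (A + B + 1)%:Z - 1) =
  (\prod_(1 <= j < L.+1) F (- j%:Z - A%:Z)) *
    \prod_(1 <= i < A.+1) \prod_(1 <= j < (minn B.+1 (l i)).+1)
       F ((i + j)%:Z - (A + B.+1 + 1)%:Z).
Proof.
move=> lmono lfull.
have -> : \prod_(1 <= i < A.+1) \prod_(1 <= j < (minn B.+1 (l i)).+1)
       F ((i + j)%:Z - (A + B.+1 + 1)%:Z) =
    (\prod_(1 <= i < A.+1) \prod_(1 <= j < (minn B (l i)).+1)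
       F ((i + j)%:Z - (A + B + 1)%:Z - 1)) *
    \prod_(1 <= i < A.+1) (if (B < l i)%N then F (i%:Z - A.+1%:Z) else 1).
  rewrite -big_split /=; apply: eq_bigr => i _; case: (ltnP B (l i)) => h.
    rewrite (minn_idPl h) (@big_nat_recr _ _ _ B.+1) //=.
    by congr (_ * _); [apply: eq_bigr => j _ | ]; congr F; lia.
  rewrite (minn_idPr (leqW h)) mulr1.
  by apply: eq_bigr => j _; congr F; lia.
rewrite [in RHS]mulrA [RHS]mulrAC; congr (_ * _).
have -> : \prod_(1 <= i < A.+1) (if (B < l i)%N then F (i%:Z - A.+1%:Z) else 1) =
    \prod_(1 <= i < (\sum_(1 <= a < A.+1) (B < l (A.+1 - a))).+1) F (- i%:Z).
  rewrite -(prod_prefix (q := fun i => (B < l (A.+1 - i))%N)); last first.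
    by move=> i j i0 ij jA /leq_trans; apply; apply: lmono; lia.
  rewrite big_nat_rev; apply: eq_big_nat => i iA.
  have -> : (1 + A.+1 - i.+1 = A.+1 - i)%N by lia.
  by case: ifP => // _; congr F; lia.
(* If [L] is positive, all [A] rows are longer than [B], so the factors at -1, ..., -A are continued
   by those at -A-1, ..., -A-L. *)
case: (posnP L) => [->|L0]; first by rewrite add0n [X in _ = X * _]big_geq // mul1r.
rewrite (eq_big_nat _ _ (F2 := fun=> 1%N)); last by move=> i iA; rewrite lfull //; lia.
rewrite sum_nat_const_nat muln1 subn1 /= mulrC.
rewrite (@big_cat_nat _ _ _ A.+1) //=; last by lia.
congr (_ * _); rewrite -add1n big_addn.
have -> : ((L + A).+1 - A = L.+1)%N by lia.
by apply: eq_bigr => j _; congr F; lia.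
Qed.

End HookProducts.

(** * Shifts of products of linear factors *)

Section Shifts.
Variables (K : fieldType) (h : K).

Definition linear_factor (z : K) (c : int) : {poly K} := 'X - z%:P + (c%:~R * h)%:P.

Lemma pshift_prod (I : Type) (r : seq I) (G : I -> {poly K}) c :
  pshift h (\prod_(i <- r) G i) c = \prod_(i <- r) pshift h (G i) c.
Proof.
rewrite /pshift; apply: (big_morph (fun f => f \Po _)).
  by move=> f g; rewrite comp_polyM.
exact: comp_polyC.
Qed.

Lemma pshift_linear_factor z c d :
  pshift h (linear_factor z c) d = linear_factor z (c - d).
Proof.
rewrite /pshift /linear_factor comp_polyD comp_polyB comp_polyX !comp_polyC.
by rewrite intrB mulrBl polyCB; ring.
Qed.

Variables (m p : nat) (z : 'I_p -> K) (lam : 'I_p -> nat -> nat).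

Lemma TpolyE mu si i : Tpoly h z mu si i =
  \prod_(k < p) \prod_(1 <= j < (mu k i).+1)
    linear_factor (z k) (if si then j%:Z else - j%:Z).
Proof.
apply: eq_bigr => k _; apply: eq_bigr => j _; rewrite /linear_factor; congr (_ + _%:P).
by case: si; rewrite ?mul1r ?mulN1r ?rmorphN.
Qed.

Lemma pshift_Tpoly mu si i d : pshift h (Tpoly h z mu si i) d =
  \prod_(k < p) \prod_(1 <= j < (mu k i).+1)
    linear_factor (z k) ((if si then j%:Z else - j%:Z) - d).
Proof.
rewrite TpolyE pshift_prod; apply: eq_bigr => k _; rewrite pshift_prod.
by apply: eq_bigr => j _; rewrite pshift_linear_factor.
Qed.

Lemma pi_polyE a b : pi_poly m h z lam a b =
  \prod_(k < p) \prod_(1 <= i < a.+1) \prod_(1 <= j < (minn b (lam k (m - i).+1)).+1)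
    linear_factor (z k) ((i + j)%:Z - (a + b + 1)%:Z).
Proof.
apply: eq_bigr => k _; apply: eq_bigr => i _; apply: eq_bigr => j _.
by rewrite /linear_factor intrB.
Qed.

Lemma pshift_pi_poly a b d : pshift h (pi_poly m h z lam a b) d =
  \prod_(k < p) \prod_(1 <= i < a.+1) \prod_(1 <= j < (minn b (lam k (m - i).+1)).+1)
    linear_factor (z k) ((i + j)%:Z - (a + b + 1)%:Z - d).
Proof.
rewrite pi_polyE pshift_prod; apply: eq_bigr => k _; rewrite pshift_prod.
apply: eq_bigr => i _; rewrite pshift_prod; apply: eq_bigr => j _.
by rewrite pshift_linear_factor.
Qed.

End Shifts.

Unset Implicit Arguments.

Theorem theorem6p4 (R : realType) (m n p : nat) (h : R[i]) (z : 'I_p -> R[i])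
  (lam : 'I_p -> nat -> nat) (M : 'I_p -> glmn_data R[i])
  (s : nat -> bool) (lams : 'I_p -> nat -> nat) :
  h != 0 ->
  h_generic h z ->
  (forall k, poly_weight m n (lam k)) ->
  (forall k, is_glmn_module m n (M k)) ->
  (forall k, irreducible_glmn m n (M k)) ->
  (forall k, has_highest_weight m n (M k) (lam k)) ->
  parity_seq m n s ->
  (forall k, exists v : gl_V (M k), s_singular m n s v /\
      forall i, inrange m n i ->
        gl_E (M k) (sigma_s m s i) (sigma_s m s i) v = (lams k i)%:R *: v) ->
  forall i, inrange m n i ->
    if s i then
      Tpoly h z lams true i
        * pshift h (pi_poly m h z lam (s_plus m n s i).+1 (s_minus s i)) (-1)
      = pshift h (T0 m h z lam (sigma_s m s i)) (s_minus s i)%:Z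
        * pi_poly m h z lam (s_plus m n s i) (s_minus s i)
    else
      Tpoly h z lams false i
        * pshift h (pi_poly m h z lam (s_plus m n s i) (s_minus s i)) 1
      = pshift h (T0 m h z lam (sigma_s m s i)) (s_plus m n s i)%:Z
        * pi_poly m h z lam (s_plus m n s i) (s_minus s i).+1.
Proof.
move=> _ _ lamP modM irrM hwM parity_s sing i imn.
have lamsE k : lams k i = shuffle_weight m (lam k) (shuffle_of m n s) (sigma_s m s i).
  have [v [vs vw]] := sing k.
  have inj j j' : inrange m n j -> inrange m n j' -> sigma_s m s j = sigma_s m s j' -> j = j'.
    move=> rj rj' e; case: (ltngtP j j') => // lt_jj'.
      by have := sigma_s_shuffle_lt parity_s rj rj' lt_jj'; rewrite e shuffle_lt_irr.
    by have := sigma_s_shuffle_lt parity_s rj' rj lt_jj'; rewrite e shuffle_lt_irr.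
  (* [lams] is indexed by positions, a weight by matrix indices. [mu] transports it along the
     inverse of [sigma_s]; injectivity leaves a single term in the sum. *)
  pose mu c := (\sum_(1 <= j < (m + n).+1) (if sigma_s m s j == c then lams k j else 0))%N.
  have muE j : inrange m n j -> mu (sigma_s m s j) = lams k j.
    move=> rj; rewrite /mu (bigD1_seq j) ?iota_uniq ?mem_index_iota //= eqxx big_seq_cond.
    rewrite big1 ?addn0 //= => j' /andP[rj' j'j]; case: eqP => // /inj e.
    by rewrite e ?eqxx // in j'j; move: rj'; rewrite mem_index_iota.
  rewrite -(muE i imn); apply: (singular_shuffle_weight (modM k) (irrM k) (lamP k) (hwM k)
    (shuffle_of_is_shuffle parity_s) (s_singular_order parity_s vs) _
    (sigma_s_range parity_s imn)).
  by move=> c /(sigma_s_surj parity_s)[j rj <-]; rewrite vw // muE.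
have im : (0 < i <= m + n)%N := imn.
case: ifP => [si|/negbT si].
  have om := sigma_s_one parity_s im si.
  have sE : sigma_s m s i = (m - (s_plus m n s i).+1).+1.
    rewrite (s_plusE parity_s) /sigma_s ?si; lia.
  rewrite /T0 pshift_Tpoly pshift_pi_poly TpolyE pi_polyE -!big_split /=.
  apply: eq_bigr => k _; rewrite lamsE (shuffle_weight_one parity_s) // sE.
  have -> : ((m - (s_plus m n s i).+1).+1 <= m)%N by lia.
  exact: (hook_row_prod (linear_factor h (z k)) _ _ (fun x => lam k (m - x).+1)).
have om := sigma_s_minus parity_s im si.
rewrite /T0 pshift_Tpoly pshift_pi_poly TpolyE pi_polyE -!big_split /=.
have sigE : sigma_s m s i = (m + (s_minus s i).+1)%N.
  by rewrite /sigma_s (negPf si) s_minusE //; case/andP: im.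
have bn : (s_minus s i < n)%N.
  by rewrite -s_minusE //; [case/andP: om | case/andP: im].
have Am : (s_plus m n s i <= m)%N by rewrite (s_plusE parity_s); lia.
apply: eq_bigr => k _; rewrite lamsE (shuffle_weight_minus parity_s) //.
have -> : (sigma_s m s i <= m)%N = false by rewrite sigE; lia.
apply: (hook_column_prod (linear_factor h (z k)) (l := fun x => lam k (m - x).+1)).
  by move=> x y x0 xy yA; apply: (poly_weight_le (lamP k)); lia.
(* A row of length at most [s_minus s i] would bound [lam k m] likewise, and the hook condition
   would make the odd entry zero, against [L0]. *)
move=> L0 x xA; rewrite ltnNge; apply/negP => hx.
have m0 : (0 < m)%N by lia.
move: L0; rewrite sigE (poly_weight_hook (lamP k)) //.
apply: leq_ltn_trans (poly_weight_le (lamP k) _ _ (leqnn m)) _; last exact: hx; lia.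
Qed.
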